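(* Let $G$ be a trivial skew left brace, $E$ a trivial left semi-brace, $\alpha:(E,\circ)\to\mathrm{Aut}(G,+,\circ)$ a homomorphism, and let $B:=G\rtimes_\alpha E$ be the semidirect product of left semi-braces. Then $b^{(3)}=0$ for all $b\in B$.
   Context: A left semi-brace is a triple $(B,+,\circ)$ where $(B,+)$ is a semigroup, $(B,\circ)$ is a group and $a\circ(b+c)=a\circ b+a\circ(a^-+c)$ for all $a,b,c\in B$, where $a^-$ is the inverse of $a$ in $(B,\circ)$ and $\circ$ has higher precedence than $+$. It is left cancellative if $(B,+)$ is left cancellative. The neutral element of $(B,\circ)$ is denoted by $0$. A skew left brace is a left semi-brace for which $(B,+)$ is a (not necessarily abelian) group; it is trivial if $a+b=a\circ b$ for all $a,b$. The trivial left semi-brace on a group $(E,\circ)$ is given by $a+b:=b$. Semidirect product: $G\rtimes_\alpha E$ is the set $G\times E$ with $(g_1,e_1)+(g_2,e_2):=(g_1+g_2,e_1+e_2)=(g_1+g_2,e_2)$ and $(g_1,e_1)\circ(g_2,e_2):=(g_1\circ\alpha_{e_1}(g_2),e_1\circ e_2)$; it is a left cancellative left semi-brace. For a left cancellative left semi-brace $B$ and $a,b\in B$, put $\lambda_a(b):=a\circ(a^-+b)$ and $a\cdot b:=\lambda_a(a^-)+a\circ b+\lambda_b(b^-)$. For $b\in B$ define $b^{(1)}:=b$ and $b^{(n+1)}:=b^{(n)}\cdot b$ for $n\geq 1$. *)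

(* Defs.v *)
From HB Require Import structures.
From mathcomp Require Import all_boot.
From mathcomp Require Import boolp.

Set Implicit Arguments.
Unset Strict Implicit.
Unset Printing Implicit Defensive.

Declare Scope brace_scope.
Delimit Scope brace_scope with B.
Local Open Scope group_scope.
Local Open Scope brace_scope.

(* The multiplicative group structure [*, ^-1, 1] of the library plays the role
   of the circle group, so the element written 0 on paper is [1]; [sadd] is the
   additive semigroup law, which need not be commutative or have a neutral
   element. *)
HB.mixin Record Group_isLeftSemibrace B of Group B := {
  sadd : B -> B -> B;
  saddA : associative sadd;
  mulg_saddr : forall a b c : B,
    a * sadd b c = sadd (a * b) (a * sadd a^-1 c)
}.

#[short(type="leftSemibraceType")]
HB.structure Definition LeftSemibrace :=
  {B of Group_isLeftSemibrace B & Group B}.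

Notation "x + y" := (sadd x y) : brace_scope.

HB.mixin Record LeftSemibrace_isCancellative B of LeftSemibrace B := {
  saddI : right_injective (@sadd B)
}.

#[short(type="lcSemibraceType")]
HB.structure Definition LCSemibrace :=
  {B of LeftSemibrace_isCancellative B & LeftSemibrace B}.

HB.mixin Record LeftSemibrace_hasOpp B of LeftSemibrace B := {
  szero : B;
  sopp : B -> B;
  sadd0b : left_id szero (@sadd B);
  saddb0 : right_id szero (@sadd B);
  saddNb : left_inverse szero sopp (@sadd B);
  saddbN : right_inverse szero sopp (@sadd B)
}.

(* Cancellativity follows from the additive group axioms, see the factory
   below; it is part of the structure only to get the inheritance. *)
#[short(type="skewLeftBraceType")]
HB.structure Definition SkewLeftBrace :=
  {B of LeftSemibrace_hasOpp B & LCSemibrace B}.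

HB.factory Record LeftSemibrace_isSkewLeftBrace B of LeftSemibrace B := {
  szero : B;
  sopp : B -> B;
  sadd0b : left_id szero (@sadd B);
  saddb0 : right_id szero (@sadd B);
  saddNb : left_inverse szero sopp (@sadd B);
  saddbN : right_inverse szero sopp (@sadd B)
}.

HB.builders Context B of LeftSemibrace_isSkewLeftBrace B.

Fact saddI : right_injective (@sadd B).
Proof.
move=> a b c /(congr1 (sadd (sopp a))).
by rewrite !saddA saddNb !sadd0b.
Qed.

HB.instance Definition _ := LeftSemibrace_isCancellative.Build B saddI.
HB.instance Definition _ :=
  LeftSemibrace_hasOpp.Build B sadd0b saddb0 saddNb saddbN.

HB.end.

Definition trivial_skew_left_brace (G : skewLeftBraceType) : Prop :=
  forall a b : G, a + b = a * b.

Section TrivialSemibrace.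
Variable E : groupType.

Definition trivial_semibrace : Type := E.

HB.instance Definition _ := Group.on trivial_semibrace.

Definition triv_add (a b : trivial_semibrace) : trivial_semibrace := b.

Fact triv_addA : associative triv_add. Proof. by []. Qed.

Fact triv_mul_addr (a b c : trivial_semibrace) :
  a * triv_add b c = triv_add (a * b) (a * triv_add a^-1 c).
Proof. by []. Qed.

HB.instance Definition _ :=
  Group_isLeftSemibrace.Build trivial_semibrace triv_addA triv_mul_addr.

Fact triv_addI : right_injective triv_add. Proof. by move=> a b c. Qed.

HB.instance Definition _ :=
  LeftSemibrace_isCancellative.Build trivial_semibrace triv_addI.

End TrivialSemibrace.

Section Automorphisms.
Variable G : leftSemibraceType.

Record brace_aut : Type := BraceAut {
  aut_fun :> G -> G;
  aut_bij : bijective aut_fun;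
  autD : {morph aut_fun : x y / x + y};
  autM : {morph aut_fun : x y / x * y}
}.

Implicit Types f g h : brace_aut.

Lemma brace_autP f g : f =1 g -> f = g.
Proof.
case: f g => [f bf df mf] [g bg dg mg] /= /funext efg.
case: g / efg bg dg mg => bg dg mg.
by rewrite (Prop_irrelevance bf bg) (Prop_irrelevance df dg)
  (Prop_irrelevance mf mg).
Qed.

HB.instance Definition _ := gen_eqMixin brace_aut.
HB.instance Definition _ := gen_choiceMixin brace_aut.

Definition aut_one : brace_aut :=
  @BraceAut id (Bijective (fun=> erefl) (fun=> erefl))
    (fun _ _ => erefl) (fun _ _ => erefl).

Fact aut_mulD f g : {morph f \o g : x y / x + y}.
Proof. by move=> x y /=; rewrite !autD. Qed.

Fact aut_mulM f g : {morph f \o g : x y / x * y}.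
Proof. by move=> x y /=; rewrite !autM. Qed.

Definition aut_mul f g : brace_aut :=
  BraceAut (bij_comp (aut_bij f) (aut_bij g)) (aut_mulD f g) (aut_mulM f g).

Fact aut_inv_ex f : exists g, cancel f g /\ cancel g f.
Proof.
case: (aut_bij f) => k fK kK.
have kD : {morph k : x y / x + y}.
  by move=> x y; apply: (can_inj fK); rewrite autD !kK.
have kM : {morph k : x y / x * y}.
  by move=> x y; apply: (can_inj fK); rewrite autM !kK.
by exists (BraceAut (Bijective kK fK) kD kM).
Qed.

Definition aut_inv f : brace_aut := projT1 (cid (aut_inv_ex f)).

Fact aut_invK f : cancel f (aut_inv f) /\ cancel (aut_inv f) f.
Proof. exact: projT2 (cid (aut_inv_ex f)). Qed.

Fact aut_mulA : associative aut_mul.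
Proof. by move=> f g h; apply: brace_autP. Qed.

Fact aut_mul1 : left_id aut_one aut_mul.
Proof. by move=> f; apply: brace_autP. Qed.

Fact aut_mulr1 : right_id aut_one aut_mul.
Proof. by move=> f; apply: brace_autP. Qed.

Fact aut_mulV : left_inverse aut_one aut_inv aut_mul.
Proof. by move=> f; apply: brace_autP => x; exact: (aut_invK f).1. Qed.

Fact aut_mulrV : right_inverse aut_one aut_inv aut_mul.
Proof. by move=> f; apply: brace_autP => x; exact: (aut_invK f).2. Qed.

HB.instance Definition _ :=
  isGroup.Build brace_aut aut_mulA aut_mul1 aut_mulr1 aut_mulV aut_mulrV.

End Automorphisms.

(* As E is a group and [brace_aut G] is a group under composition,
   [{multiplicative E -> brace_aut G}] is the type of group homomorphisms.
   The product carries [alpha] in its type only to select the operations. *)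
Definition semidirect (G E : leftSemibraceType)
  (alpha : {multiplicative E -> brace_aut G}) : Type := (G * E)%type.

Section Semidirect.
Variables (G E : leftSemibraceType) (alpha : {multiplicative E -> brace_aut G}).

Local Notation B := (semidirect alpha).

HB.instance Definition _ := Choice.copy B (G * E)%type.

Definition sd_add (a b : B) : B := (a.1 + b.1, a.2 + b.2).
Definition sd_mul (a b : B) : B := (a.1 * alpha a.2 b.1, a.2 * b.2).
Definition sd_one : B := (1, 1).
Definition sd_inv (a : B) : B := (alpha a.2^-1 a.1^-1, a.2^-1).

Fact sd_act_mul e f g : alpha (e * f) g = alpha e (alpha f g).
Proof. by rewrite gmulfM. Qed.

Fact sd_act1 g : alpha 1 g = g.
Proof.
by apply: (bij_inj (aut_bij (alpha 1))); rewrite -sd_act_mul mulg1.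
Qed.

Fact aut1 (f : brace_aut G) : f 1 = 1.
Proof. by apply: (@mulgI _ (f 1)); rewrite -autM !mulg1. Qed.

Fact sd_mulA : associative sd_mul.
Proof.
by move=> a b c; rewrite /sd_mul /= autM sd_act_mul !mulgA.
Qed.

Fact sd_mul1 : left_id sd_one sd_mul.
Proof. by case=> g e; rewrite /sd_mul /= sd_act1 !mul1g. Qed.

Fact sd_mulr1 : right_id sd_one sd_mul.
Proof. by case=> g e; rewrite /sd_mul /= aut1 !mulg1. Qed.

Fact sd_mulV : left_inverse sd_one sd_inv sd_mul.
Proof. by case=> g e; rewrite /sd_mul /= -autM !mulVg aut1. Qed.

Fact sd_mulrV : right_inverse sd_one sd_inv sd_mul.
Proof.
by case=> g e; rewrite /sd_mul /= -sd_act_mul !mulgV sd_act1 mulgV.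
Qed.

HB.instance Definition _ :=
  isGroup.Build B sd_mulA sd_mul1 sd_mulr1 sd_mulV sd_mulrV.

Fact sd_addA : associative sd_add.
Proof. by move=> a b c; rewrite /sd_add /= !saddA. Qed.

Fact sd_mul_addr (a b c : B) :
  a * sd_add b c = sd_add (a * b) (a * sd_add a^-1 c).
Proof.
congr pair; last exact: mulg_saddr.
by rewrite /= !autD -sd_act_mul mulgV sd_act1 mulg_saddr.
Qed.

HB.instance Definition _ :=
  Group_isLeftSemibrace.Build B sd_addA sd_mul_addr.

End Semidirect.

Section SemidirectCancellative.
Variables (G E : lcSemibraceType) (alpha : {multiplicative E -> brace_aut G}).

Fact sd_addI : right_injective (@sd_add G E alpha).
Proof. by move=> [g e] [h1 f1] [h2 f2] [] /saddI -> /saddI ->. Qed.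

HB.instance Definition _ :=
  LeftSemibrace_isCancellative.Build (semidirect alpha) sd_addI.

End SemidirectCancellative.

Section Dot.
Variable B : lcSemibraceType.
Implicit Types a b : B.

Definition lam a b : B := a * (a^-1 + b).

Definition dot a b : B := lam a a^-1 + a * b + lam b b^-1.

(* [dotpow b n] is b^(n) for n >= 1; the value at n = 0, namely b, is junk. *)
Definition dotpow b (n : nat) : B := iter n.-1 (fun x => dot x b) b.

End Dot.

(* Main.v *)
(** For a = (g, e), the element lambda_a(a^-) is (g^-1, 1), so that
    (g, e) . (h, f) = (alpha_e(h) h^-1, 1).  Hence any product has second
    component 1, and multiplying it by (h, f) gives (h h^-1, 1). *)
Require Import Defs.
From HB Require Import structures.
From mathcomp Require Import all_boot.

Local Open Scope group_scope.

Section TrivialSemidirect.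
Variables (G : skewLeftBraceType) (E : groupType).
Variable alpha : {multiplicative trivial_semibrace E -> brace_aut G}.
Hypothesis hG : trivial_skew_left_brace G.
Implicit Types a b : semidirect alpha.

(** For a = (g, e), the inverse has first component x = alpha_{e^-1}(g^-1). Since [hG] turns x + x
    into x * x, alpha_e maps it to g^-1 * g^-1, and g cancels one factor. *)
Lemma lam_invE a : lam a a^-1 = (a.1^-1, 1) :> semidirect alpha.
Proof.
congr pair; last exact: mulgV.
by rewrite /= hG autM -sd_act_mul mulgV sd_act1 mulgA mulgV mul1g.
Qed.

(** In G the sum becomes the product g^-1 * (g * alpha_e(h)) * h^-1; in E only the last summand
    survives, with component 1. *)
Lemma dotE a b : dot a b = (alpha a.2 b.1 * b.1^-1, 1) :> semidirect alpha.
Proof. by rewrite /dot !lam_invE; congr pair; rewrite /= !hG mulKg. Qed.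

End TrivialSemidirect.

Theorem proposition6p4 (G : skewLeftBraceType) (E : groupType)
  (alpha : {multiplicative trivial_semibrace E -> brace_aut G})
  (hG : trivial_skew_left_brace G) (b : semidirect alpha) :
  dotpow b 3 = 1%g.
(* Two iterations give [dot (dot b b) b], whose left factor acts through [alpha 1]. *)
Proof. by rewrite /dotpow /= !dotE //= sd_act1 mulgV. Qed.
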